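(* Let $B$ be a finite set in a group and let $\alpha,\beta>0$. Suppose that $|BB|\leq\alpha|B|$ and that $|BbB|\leq\beta|B|$ for all $b\in B$. Then $$|BBB|\leq\alpha^7\beta\,|B|.$$
   Context: For subsets $U,V$ of a group, $UV=\{uv:u\in U,v\in V\}$ (longer products similarly); $BbB=\{b_1bb_2:b_1,b_2\in B\}$. *)

(* Defs.v *)
From HB Require Import structures.
From mathcomp Require Import all_boot all_order all_algebra.
From mathcomp Require Import finmap reals.

Set Implicit Arguments.
Unset Strict Implicit.
Unset Printing Implicit Defensive.

Import Order.TTheory GRing.Theory Num.Theory.

Local Open Scope group_scope.
Local Open Scope fset_scope.

(* [groupType] is the structure of arbitrary, possibly infinite and
   non-commutative groups; it carries a choiceType structure, so its finite
   subsets form the type [{fset G}]. *)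
Definition prodfs (G : groupType) (U V : {fset G}) : {fset G} :=
  [fset u * v | u in U, v in V].

Definition sandfs (G : groupType) (B : {fset G}) (b : G) : {fset G} :=
  [fset b1 * b * b2 | b1 in B, b2 in B].

(* Main.v *)
(** Choose a nonempty X <= B minimising |XB|/|X|, so that |XB| <= alpha |X| and
    |B| <= alpha |X|.  Petridis' lemma gives |CXB| <= alpha |CX| for every
    finite C, and Ruzsa's covering lemma gives B <= T X X^-1 with T <= B and
    |T| <= |BB|/|X| <= alpha^2.  For t in T, Ruzsa's triangle inequality yields
      |B t X X^-1 B| |B| <= |B t X B| |B^-1 X^-1 B|,
    where |B t X B| <= alpha |B t B| <= alpha beta |B|, and
    |B^-1 X^-1 B| = |B^-1 X B| <= alpha |B^-1 X| <= alpha^3 |B| by Petridis'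
    lemma and the triangle inequality again.  Summing over T,
    |BBB| <= alpha^6 beta |B|; finally alpha >= 1 unless B is empty. *)
Require Import Defs.
From HB Require Import structures.
From mathcomp Require Import all_boot all_order all_algebra.
From mathcomp Require Import finmap reals zify ring lra.

Set Implicit Arguments.
Unset Strict Implicit.
Unset Printing Implicit Defensive.

Import Order.TTheory GRing.Theory Num.Theory.

Local Open Scope fset_scope.
Local Open Scope ring_scope.

Section ProductSets.
Variable G : groupType.
Implicit Types (A B C T U V W X Z : {fset G}) (b u x : G).

(** * Algebra of product sets and inverse sets *)

Lemma prodfsP U V x :
  reflect (exists u v, [/\ u \in U, v \in V & x = (u * v)%g])
          (x \in prodfs U V).
Proof.
apply: (iffP (imfset2P _ _ _ _ _)) => /= [[u uU [v vV ->]]|[u [v [uU vV ->]]]].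
  by exists u, v.
by exists u => //; exists v.
Qed.

Lemma mem_prodfs U V u v : u \in U -> v \in V -> (u * v)%g \in prodfs U V.
Proof. by move=> uU vV; apply/prodfsP; exists u, v. Qed.

Lemma prodfsS U U' V V' :
  U `<=` U' -> V `<=` V' -> prodfs U V `<=` prodfs U' V'.
Proof.
move=> /fsubsetP sU /fsubsetP sV; apply/fsubsetP => x.
case/prodfsP => u [v [uU vV ->]].
by rewrite mem_prodfs ?sU ?sV.
Qed.

Lemma prodfsA U V W : prodfs U (prodfs V W) = prodfs (prodfs U V) W.
Proof.
apply/fsetP => x; apply/prodfsP/prodfsP.
  move=> [u [_ [uU /prodfsP[v [w [vV wW ->]]] ->]]].
  by exists (u * v)%g, w; rewrite mulgA mem_prodfs.
move=> [_ [w [/prodfsP[u [v [uU vV ->]]] wW ->]]].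
by exists u, (v * w)%g; rewrite mulgA mem_prodfs.
Qed.

Lemma prodfsUl U V W : prodfs (U `|` V) W = prodfs U W `|` prodfs V W.
Proof.
apply/fsetP => x; apply/prodfsP/fsetUP => [[u [w [/fsetUP[uU|uV] wW ->]]]|].
- by left; apply: mem_prodfs.
- by right; apply: mem_prodfs.
by move=> [] /prodfsP[u [w [uU wW ->]]]; exists u, w; rewrite inE uU ?orbT.
Qed.

Lemma prodfsUr U V W : prodfs U (V `|` W) = prodfs U V `|` prodfs U W.
Proof.
apply/fsetP => x; apply/prodfsP/fsetUP => [[u [w [uU /fsetUP[wV|wW] ->]]]|].
- by left; apply: mem_prodfs.
- by right; apply: mem_prodfs.
by move=> [] /prodfsP[u [w [uU wW ->]]]; exists u, w; rewrite inE wW ?orbT.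
Qed.

Lemma prodfs0l V : prodfs fset0 V = fset0.
Proof.
by apply/fsetP => x; rewrite inE; apply/negP => /prodfsP[u [v []]]; rewrite inE.
Qed.

Lemma prodfs0r U : prodfs U fset0 = fset0.
Proof.
apply/fsetP => x; rewrite inE; apply/negP => /prodfsP[u [v []]].
by rewrite inE.
Qed.

Lemma card_prodfs1l x U : #|` prodfs [fset x] U| = #|` U|.
Proof.
suff -> : prodfs [fset x] U = [fset (x * u)%g | u in U].
  exact/card_imfset/mulgI.
apply/fsetP => y.
apply/prodfsP/imfsetP => /= [[a [u [/fset1P-> uU ->]]]|[u uU ->]].
  by exists u.
by exists x, u; rewrite inE.
Qed.

Definition invfs U : {fset G} := [fset (u^-1)%g | u in U].

Lemma mem_invfs U u : (u \in invfs U) = (u^-1%g \in U).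
Proof.
apply/imfsetP/idP => /= [[v vU ->]|uU]; first by rewrite invgK.
by exists u^-1%g; rewrite ?invgK.
Qed.

Lemma invfsK U : invfs (invfs U) = U.
Proof. by apply/fsetP => u; rewrite !mem_invfs invgK. Qed.

Lemma card_invfs U : #|` invfs U| = #|` U|.
Proof. exact/card_imfset/invg_inj. Qed.

Lemma invfs_prodfs U V : invfs (prodfs U V) = prodfs (invfs V) (invfs U).
Proof.
apply/fsetP => x; rewrite mem_invfs.
apply/prodfsP/prodfsP => [[u [v [uU vV e]]]|[v [u [vV uU ->]]]].
  exists v^-1%g, u^-1%g; rewrite !mem_invfs !invgK; split=> //.
  by rewrite -invgM -e invgK.
by exists u^-1%g, v^-1%g; rewrite -!mem_invfs !invgM.
Qed.

(** * Triangle inequality and Petridis' lemma *)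

(* With p = y(p) z(p) a chosen factorisation, (w, p) is recovered from
   (y(p) w, w^-1 z(p)), whose product is p. *)
Lemma ruzsa_triangle U V W :
  (#|` W| * #|` prodfs U V| <= #|` prodfs U W| * #|` prodfs (invfs W) V|)%N.
Proof.
(* The default [1] is returned only when [p] lies outside UV. *)
pose y p := head 1%g [seq u <- U | (u^-1 * p)%g \in V].
have yP p : p \in prodfs U V -> (y p \in U) && (((y p)^-1 * p)%g \in V).
  case/prodfsP => u [v [uU vV ->]]; rewrite andbC.
  rewrite -(mem_filter (fun t => (t^-1 * (u * v))%g \in V)) /y.
  have: u \in [seq t <- U | (t^-1 * (u * v))%g \in V].
    by rewrite mem_filter mulKg vV.
  by case: filter => //= a s _; rewrite mem_head.
pose f w p := ((y p * w)%g, (w^-1 * ((y p)^-1 * p))%g).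
rewrite -(size_allpairs f) -(size_allpairs pair); apply: uniq_leq_size.
  apply: allpairs_uniq; rewrite ?fset_uniq // => -[w p] [w' p'] /= _ _.
  rewrite /f => -[e1 e2].
  have e : p = p'.
    have := congr2 (fun a b : G => (a * b)%g) e1 e2.
    by rewrite -!mulgA !mulVKg.
  by move: e1; rewrite e => /mulgI ->.
move=> _ /allpairsP[[w p] [/= wW /yP/andP[yU zV] ->]].
apply: allpairs_f; apply: mem_prodfs => //.
by rewrite mem_invfs invgK.
Qed.

(* Petridis' lemma, with the minimality of the ratio |XB|/|X| among the subsets
   of X cross-multiplied. *)
Lemma petridis X B C :
  (forall Z, Z `<=` X ->
     #|` prodfs X B| * #|` Z| <= #|` prodfs Z B| * #|` X|)%N ->
  (#|` prodfs (prodfs C X) B| * #|` X| <=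
     #|` prodfs X B| * #|` prodfs C X|)%N.
Proof.
move=> minX; elim/fset1U_rect: C => [|c C _ IH].
  by rewrite !prodfs0l cardfs0 mul0n.
(* Inserting [c] into [C] adds at least |X| - |Z| elements to CX and at most |XB| - |ZB| elements to
   CXB; minimality of [X] compares the two increments. *)
pose Z := [fset x in X | (c * x)%g \in prodfs C X].
have sZX : Z `<=` X by apply/fsubsetP => x; rewrite !inE => /andP[].
have cI : prodfs [fset c] X `&` prodfs C X `<=` prodfs [fset c] Z.
  apply/fsubsetP => _ /fsetIP[/prodfsP[a [x [/fset1P-> xX ->]]] cxCX].
  by rewrite mem_prodfs ?inE ?xX.
have cZ : prodfs (prodfs [fset c] Z) B `<=` prodfs (prodfs C X) B.
  apply: prodfsS => //; apply/fsubsetP => _ /prodfsP[a [x [/fset1P-> xZ ->]]].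
  by move: xZ; rewrite !inE => /andP[].
have cardX : (#|` prodfs C X| + #|` X| <= #|` prodfs (c |` C) X| + #|` Z|)%N.
  rewrite prodfsUl -(card_prodfs1l c X) -(card_prodfs1l c Z) addnC.
  by rewrite -cardfsUI leq_add2l fsubset_leq_card.
have cardXB : (#|` prodfs (prodfs (c |` C) X) B| + #|` prodfs Z B| <=
               #|` prodfs (prodfs C X) B| + #|` prodfs X B|)%N.
  rewrite prodfsUl prodfsUl -(card_prodfs1l c (prodfs X B)).
  rewrite -(card_prodfs1l c (prodfs Z B)) !prodfsA.
  rewrite [leqRHS]addnC -[leqRHS]cardfsUI leq_add2l fsubset_leq_card //.
  rewrite fsubsetI cZ andbT; apply: prodfsS => //; exact: prodfsS.
have := minX Z sZX; nia.
Qed.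

(** * Minimal ratio, covering and union bound *)

(** [B] has finitely many subsets. The empty one is excluded since its ratio 0 / 0 evaluates to 0
    and would be minimal. *)
Lemma ex_min_ratio B : B != fset0 ->
  exists X, [/\ X `<=` B, X != fset0 &
    forall Z, Z `<=` B -> Z != fset0 ->
      #|` prodfs X B| * #|` Z| <= #|` prodfs Z B| * #|` X|]%N.
Proof.
move=> B0.
pose ratio X : rat := #|` prodfs X B|%:R / #|` X|%:R.
have BB : B \in fpowerset B by rewrite fpowersetE.
pose nz := [pred X : fpowerset B | val X != fset0].
have nzB : nz [` BB] by [].
have [X nzX minX] := @Order.TotalTheory.arg_minP _ _ _ [` BB] nz
  (fun X : fpowerset B => ratio (val X)) nzB.
exists (val X); split=> //; first by rewrite -fpowersetE (valP X).
move=> Z; rewrite -fpowersetE => ZB Z0.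
move: (minX [` ZB] Z0); rewrite /ratio /=.
rewrite ler_pdivrMr ?ltr0n ?cardfs_gt0 // mulrAC.
by rewrite ler_pdivlMr ?ltr0n ?cardfs_gt0 // -!natrM ler_nat.
Qed.

(** [T] grows greedily while the translates tX stay disjoint, which |T| |X| = |TX| records; if uX
    meets tX, then u lies in tXX^-1. *)
Lemma ruzsa_covering X U : X != fset0 ->
  exists T, [/\ T `<=` U, (#|` T| * #|` X| = #|` prodfs T X|)%N &
    U `<=` prodfs T (prodfs X (invfs X))].
Proof.
case/fset0Pn => a aX; elim/fset1U_rect: U => [|u U _ [T [sTU cT sU]]].
  by exists fset0; rewrite fsub0set prodfs0l cardfs0.
case: (boolP (u \in prodfs T (prodfs X (invfs X)))) => [uT|uNT].
  exists T; split=> //; first exact/(fsubset_trans sTU)/fsubsetUr.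
  by rewrite fsubUset fsub1set uT.
have disj : [disjoint prodfs [fset u] X & prodfs T X]%fset.
  apply/fdisjointP => _ /prodfsP[b [x [/fset1P-> xX ->]]].
  apply: contra uNT => uxTX.
  by rewrite prodfsA -(mulgK x u) mem_prodfs // mem_invfs invgK.
have uT : u \notin T.
  apply: contraL disj => uT; apply/negP => /fdisjointP/(_ (u * a)%g).
  by rewrite !mem_prodfs ?inE // => /(_ isT).
exists (u |` T); split; first exact: fsetUS.
  rewrite cardfsU1 uT prodfsUl cardfsU (disjoint_fsetI0 disj) cardfs0 subn0.
  by rewrite mulnDl mul1n card_prodfs1l cT.
rewrite prodfsUl fsetUSS // fsub1set -{1}(mulg1 u) -(mulgV a).
by rewrite mem_prodfs ?fset11 // mem_prodfs // mem_invfs invgK.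
Qed.

(** Union bound over the slices AtC with t in [T]. *)
Lemma card_prodfs_mid (R : numDomainType) (c : R) A T C :
  (forall t, t \in T -> #|` prodfs (prodfs A [fset t]) C|%:R <= c) ->
  #|` prodfs (prodfs A T) C|%:R <= #|` T|%:R * c.
Proof.
elim/fset1U_rect: T => [|t T tT IH] hc.
  by rewrite prodfs0r prodfs0l cardfs0 mul0r.
rewrite prodfsUr prodfsUl cardfsU1 tT natrD mulrDl mul1r.
apply: (@le_trans _ _ (#|` prodfs (prodfs A [fset t]) C|%:R +
                       #|` prodfs (prodfs A T) C|%:R)).
  by rewrite -natrD ler_nat leq_card_fsetU.
apply: lerD; first by apply: hc; rewrite fset1U1.
by apply: IH => s sT; apply: hc; rewrite fset1Ur.
Qed.

Lemma prodfs_sandfs B b : prodfs (prodfs B [fset b]) B `<=` sandfs B b.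
Proof.
apply/fsubsetP => _ /prodfsP[_ [v [/prodfsP[u [a [uB /fset1P-> ->]]] vB ->]]].
exact: in_imfset2.
Qed.

End ProductSets.

(** * Tripling estimate from the sandwich bounds *)

Theorem theorem4p4 (R : realType) (G : groupType) (B : {fset G})
    (alpha beta : R) (alpha_gt0 : 0 < alpha) (beta_gt0 : 0 < beta)
    (hBB : #|` prodfs B B|%:R <= alpha * #|` B|%:R)
    (hBbB : forall b : G, b \in B ->
      #|` sandfs B b|%:R <= beta * #|` B|%:R) :
  #|` prodfs (prodfs B B) B|%:R <= alpha ^+ 7 * beta * #|` B|%:R.
Proof.
have [->|B0] := eqVneq B fset0; first by rewrite !prodfs0r cardfs0 mulr0.
have [X [sXB X0 minX]] := ex_min_ratio B0.
have petridisX C : (#|` prodfs (prodfs C X) B| * #|` X| <=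
                    #|` prodfs X B| * #|` prodfs C X|)%N.
  apply: petridis => Z sZX; have [->|Z0] := eqVneq Z fset0.
    by rewrite cardfs0 muln0.
  by apply: minX => //; apply: fsubset_trans sXB.
have [T [sTB cardT coverB]] := ruzsa_covering B X0.
set n : R := #|` B|%:R in hBB hBbB *; set a : R := #|` X|%:R.
have n0 : 0 < n by rewrite ltr0n cardfs_gt0.
have a0 : 0 < a by rewrite ltr0n cardfs_gt0.
(* Minimality of [X] is tested against [B] itself. *)
have XBa : #|` prodfs X B|%:R <= alpha * a.
  rewrite -(ler_pM2r n0) mulrAC.
  apply: (@le_trans _ _ (#|` prodfs B B|%:R * a)).
    by rewrite -!natrM ler_nat minX.
  by rewrite ler_pM2r.
have CXB C : #|` prodfs (prodfs C X) B|%:R <= alpha * #|` prodfs C X|%:R.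
  rewrite -(ler_pM2r a0).
  apply: (@le_trans _ _ (#|` prodfs X B|%:R * #|` prodfs C X|%:R)).
    by rewrite -!natrM ler_nat.
  by rewrite mulrAC ler_wpM2r.
(* XB contains a translate of [B]. *)
have na : n <= alpha * a.
  apply: le_trans XBa; rewrite ler_nat; case/fset0Pn: X0 => x xX.
  by rewrite -(card_prodfs1l x) fsubset_leq_card // prodfsS ?fsub1set.
have alpha1 : 1 <= alpha.
  rewrite -(ler_pM2r n0) mul1r; apply: le_trans hBB; rewrite ler_nat.
  case/fset0Pn: B0 => b bB.
  by rewrite -(card_prodfs1l b) fsubset_leq_card // prodfsS ?fsub1set.
(* |T| |X| = |TX| <= |BB| <= alpha |B| <= alpha^2 |X|. *)
have TB : #|` T|%:R <= alpha ^+ 2.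
  rewrite -(ler_pM2r a0) expr2 -mulrA.
  apply: (@le_trans _ _ (alpha * n)); last by rewrite ler_pM2l.
  apply: le_trans hBB; rewrite -natrM ler_nat cardT.
  by rewrite fsubset_leq_card // prodfsS.
(* Triangle inequality for B^-1 and X through W = B^-1; both factors are at most |BB|, the first
   after inversion. *)
have BVX : #|` prodfs (invfs B) X|%:R <= alpha ^+ 2 * n.
  rewrite -(ler_pM2l n0).
  apply: (@le_trans _ _ (#|` prodfs B B|%:R * #|` prodfs B B|%:R)).
    rewrite /n -(card_invfs B) -!natrM ler_nat.
    apply: leq_trans (ruzsa_triangle _ _ (invfs B)) _.
    rewrite invfsK -invfs_prodfs card_invfs.
    by rewrite leq_mul2l fsubset_leq_card ?orbT // prodfsS.
  have := ler_pM (ler0n _ _) (ler0n _ _) hBB hBB; lra.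
have BtXXB t : t \in T ->
    #|` prodfs (prodfs B [fset t])
          (prodfs (prodfs X (invfs X)) B)|%:R <= alpha ^+ 4 * beta * n.
  move=> /(fsubsetP sTB) tB; rewrite -(prodfsA X) (prodfsA _ X) -(ler_pM2l n0).
  set Y := prodfs (prodfs B [fset t]) X.
  (* Petridis' lemma with C = Bt, then BtX lies in BtB. *)
  have hY : #|` prodfs Y B|%:R <= alpha * (beta * n).
    apply: le_trans (CXB _) _; rewrite ler_pM2l //.
    apply: le_trans (hBbB t tB); rewrite ler_nat fsubset_leq_card //.
    exact/(fsubset_trans _ (prodfs_sandfs _ _))/prodfsS.
  (* Inversion turns this set into B^-1 X B, where Petridis' lemma applies with C = B^-1. *)
  have hZ : #|` prodfs (invfs B) (prodfs (invfs X) B)|%:R <=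
            alpha * (alpha ^+ 2 * n).
    rewrite -card_invfs !invfs_prodfs !invfsK.
    by apply: le_trans (CXB _) _; rewrite ler_pM2l.
  apply: (@le_trans _ _ (alpha * (beta * n) * (alpha * (alpha ^+ 2 * n)))).
    apply: le_trans (ler_pM (ler0n _ _) (ler0n _ _) hY hZ).
    by rewrite -!natrM ler_nat ruzsa_triangle.
  lra.
(* The middle factor is the one covered by TXX^-1, so each slice starts with Bt and the sandwich
   bound applies. *)
have BBB : #|` prodfs (prodfs B B) B|%:R <=
           #|` T|%:R * (alpha ^+ 4 * beta * n).
  apply: le_trans (card_prodfs_mid BtXXB); rewrite ler_nat fsubset_leq_card //.
  by rewrite prodfsA -(prodfsA B T) !prodfsS.
apply: le_trans BBB _.
apply: (@le_trans _ _ (alpha ^+ 6 * (beta * n))).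
  have -> : alpha ^+ 6 * (beta * n) = alpha ^+ 2 * (alpha ^+ 4 * beta * n).
    by ring.
  by rewrite ler_wpM2r // !mulr_ge0 ?exprn_ge0 // ltW.
(* Raising the exponent from 6 to 7 uses [alpha1]. *)
by rewrite -mulrA ler_wpM2r ?ler_weXn2l // mulr_ge0 // ltW.
Qed.
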